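(* Let $(M^{2d},\omega,\Theta,g)$ be an almost Kähler manifold. Then it is a Kähler manifold if and only if it is a statistical almost-Kähler manifold, i.e. if and only if there exists a pair $(\nabla,\nabla^* )$ of torsion-free linear connections on $M^{2d}$, dual with respect to $g$, such that $\nabla\omega=0$.
   Context: An almost Kähler manifold $(M^{2d},\omega,\Theta,g)$ is a symplectic manifold $(M^{2d},\omega)$ with an almost Hermitian structure $(g,\Theta)$: $\Theta$ is an almost complex structure, $g$ a $\Theta$-invariant Riemannian metric, and $\omega=g(\Theta\cdot,\cdot)$. It is Kähler if $\nabla^{lc}\omega=0$ for the Levi-Civita connection $\nabla^{lc}$ of $g$ (equivalently $\Theta$ is integrable). The dual connection $\nabla^*$ of $\nabla$ with respect to $g$ is defined by $X\,g(Y,Z)=g(\nabla_XY,Z)+g(Y,\nabla^*_XZ)$. The set of SMAT connections on an almost Kähler manifold is the set of pairs $(\nabla,\nabla^* )$ dual with respect to $g$ with $\nabla\omega=0$ and $\nabla$ torsion-free; a statistical almost-Kähler manifold is an almost Kähler manifold for which this set contains a pair with both $\nabla$ and $\nabla^*$ torsion-free (statistical symplectic connections). *)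

(* Defs.v *)
From HB Require Import structures.
From mathcomp Require Import all_boot all_order all_algebra.
From mathcomp Require Import all_classical all_reals all_analysis.
From mathcomp Require Import ring lra.

Set Implicit Arguments.
Unset Strict Implicit.
Unset Printing Implicit Defensive.

Import Order.TTheory GRing.Theory Num.Theory.
Import numFieldNormedType.Exports.

Local Open Scope classical_set_scope.
Local Open Scope ring_scope.

Section Smooth.
Context {R : realType} {V W : normedModType R}.

(* Only used with U open.  Differentiable with all directional derivatives C^k
   is C^(k+1): in finite dimension, take v among the basis vectors. *)
Fixpoint Ck (k : nat) (U : set V) (f : V -> W) : Prop :=
  match k with
  | 0 => forall x, U x -> {for x, continuous f}
  | k'.+1 => (forall x, U x -> differentiable f x) /\
             (forall v : V, Ck k' U ('D_v f))
  end.

Definition smooth_on (U : set V) (f : V -> W) := forall k, Ck k U f.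

Lemma near0_differentiable (h : V -> W) (x : V) :
  (\forall y \near x, h y = 0) -> differentiable h x.
Proof.
move=> h0; have hx : h x = 0 by exact: (nbhs_singleton h0).
have o0 (k : V -> W) : k = 0 -> h \o shift x = cst (h x) + k +o_ (0 : V) id.
  move=> ->; apply/eqaddoP => _/posnumP[e].
  have h0' : \forall y \near (0 : V), h (y + x) = 0.
    by move: h0; rewrite (near_shift 0) subr0.
  near=> y; rewrite [_ y](_ : _ = 0) ?normr0 ?mulr_ge0//.
  rewrite hx -[LHS]/(h (y + x) - (0 + 0)) addr0 subr0.
  by near: y.
have E : 'd h x = (0 : V -> W) :> (V -> W).
  by apply: (@diff_unique _ _ _ _ \0); [exact: cst_continuous|exact: o0].
apply/diff_locallyP; rewrite E; split; first exact: cst_continuous.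
exact: o0.
Unshelve. all: by end_near. Qed.

End Smooth.

Section CkTheory.
Context {R : realType} {V : normedModType R}.
Implicit Types (U : set V) (f g : V -> R).

Lemma Ck_eq k U f g : open U -> (forall x, U x -> f x = g x) ->
  Ck k U f -> Ck k U g.
Proof.
move=> oU; have nU x : U x -> nbhs x U by move=> Ux; exact: open_nbhs_nbhs.
elim: k f g => [|k IH] f g fg /=.
  move=> cf x Ux; rewrite /prop_for /continuous_at -(fg _ Ux).
  apply: cvg_trans (cf x Ux); apply: near_eq_cvg.
  by near=> y; apply: fg; near: y; exact: nU.
case=> df dD; split.
  move=> x Ux; have -> : g = (g - f) + f by rewrite subrK.
  apply: differentiableD (df x Ux); apply: near0_differentiable.
  near=> y; rewrite -[LHS]/(g y - f y) fg ?subrr//.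
  by near: y; exact: nU.
move=> v; apply: IH (dD v) => x Ux; apply: near_eq_derive.
by near=> y; apply: fg; near: y; exact: nU.
Unshelve. all: by end_near. Qed.

Lemma CkS k U f : Ck k.+1 U f -> Ck k U f.
Proof.
elim: k f => [|k IH] f /=; first by case=> df _ x Ux; exact/differentiable_continuous/df.
by case=> df dD; split=> // v; apply: IH; exact: dD.
Qed.

Lemma Ck_cst k U (a : R) : Ck k U (cst a).
Proof.
elim: k a => [|k IH] a /=; first by move=> x _; exact: cst_continuous.
split=> [x _|v]; first exact: differentiable_cst.
have -> : 'D_v (cst a : V -> R) = cst 0 by apply/funext => x; exact: derive_cst.
exact: IH.
Qed.

Lemma Ck_add k U f g : open U -> Ck k U f -> Ck k U g -> Ck k U (f + g).
Proof.
move=> oU; elim: k f g => [|k IH] f g /=.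
  by move=> cf cg x Ux; apply: cvgD; [exact: cf|exact: cg].
case=> df Df [dg Dg]; split=> [x Ux|v].
  by apply: differentiableD; [exact: df|exact: dg].
apply: Ck_eq (IH _ _ (Df v) (Dg v)) => // x Ux.
by rewrite deriveD//; apply: diff_derivable; [exact: df|exact: dg].
Qed.

Lemma Ck_mul k U f g : open U -> Ck k U f -> Ck k U g -> Ck k U (f * g).
Proof.
move=> oU; elim: k f g => [|k IH] f g.
  by move=> cf cg x Ux; apply: cvgM; [exact: cf|exact: cg].
move=> Cf Cg; move: (Cf) (Cg) => [df Df] [dg Dg]; split=> [x Ux|v].
  by apply: differentiableM; [exact: df|exact: dg].
have E := Ck_add oU (IH _ _ (CkS Cf) (Dg v)) (IH _ _ (CkS Cg) (Df v)).
apply: Ck_eq E => // x Ux.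
by rewrite deriveM//; apply: diff_derivable; [exact: df|exact: dg].
Qed.

End CkTheory.

Section Manifold.
Context (R : realType) (n : nat).

(* [chart_inv] is constrained on the image of the chart domain only. *)
Record chart (M : topologicalType) := Chart {
  chart_dom : set M;
  chart_map :> M -> 'rV[R]_n;
  chart_inv : 'rV[R]_n -> M;
  chart_dom_open : open chart_dom;
  chart_img_open : open (chart_map @` chart_dom);
  chart_mapK : {in chart_dom, cancel chart_map chart_inv};
  chart_map_cont : forall x, chart_dom x -> {for x, continuous chart_map};
  chart_inv_cont : forall y, (chart_map @` chart_dom) y ->
                   {for y, continuous chart_inv} }.

Record manifold := Manifold {
  carrier :> topologicalType;
  atlas : set (chart carrier);
  mfd_hausdorff : hausdorff_space carrier;
  mfd_countable : @second_countable carrier;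
  atlas_cover : forall x, exists2 c, atlas c & chart_dom c x;
  atlas_compat : forall c1 c2, atlas c1 -> atlas c2 ->
    smooth_on (c1 @` (chart_dom c1 `&` chart_dom c2)) (c2 \o chart_inv c1) }.

End Manifold.

Section SmoothFunctions.
Context (R : realType) (n : nat) (M : manifold R n).

Definition smooth_fun (f : M -> R) := forall c : chart R n M, atlas c ->
  smooth_on (c @` chart_dom c) (f \o chart_inv c).

Definition smooth_pred : {pred M -> R} := fun f => `[< smooth_fun f >].

Lemma smooth_cst (a : R) : smooth_fun (cst a).
Proof. by move=> c _ k; exact: Ck_cst. Qed.

Lemma smoothD f g : smooth_fun f -> smooth_fun g -> smooth_fun (f + g).
Proof.
move=> sf sg c Ac k.
by apply: Ck_add; [exact: chart_img_open|exact: sf|exact: sg].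
Qed.

Lemma smoothM f g : smooth_fun f -> smooth_fun g -> smooth_fun (f * g).
Proof.
move=> sf sg c Ac k.
by apply: Ck_mul; [exact: chart_img_open|exact: sf|exact: sg].
Qed.

Lemma smoothZ (a : R) f : smooth_fun f -> smooth_fun (a *: f).
Proof. by move=> sf; exact: smoothM (smooth_cst a) sf. Qed.

Lemma smoothB f g : smooth_fun f -> smooth_fun g -> smooth_fun (f - g).
Proof. by move=> sf sg; rewrite -scaleN1r; exact/smoothD/smoothZ. Qed.

Lemma smooth_subring : subring_closed smooth_pred.
Proof.
split=> [|f g|f g].
- apply/asboolP; exact: (smooth_cst 1).
- by move=> /asboolP sf /asboolP sg; exact/asboolP/smoothB.
- by move=> /asboolP sf /asboolP sg; exact/asboolP/smoothM.
Qed.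

Lemma smooth_scaler : scaler_closed smooth_pred.
Proof. by move=> a f /asboolP sf; exact/asboolP/smoothZ. Qed.

HB.instance Definition _ :=
  GRing.isSubringClosed.Build (M -> R) smooth_pred smooth_subring.
HB.instance Definition _ :=
  GRing.isScaleClosed.Build R (M -> R) smooth_pred smooth_scaler.

Record Cinf := MkCinf {
  Cinf_val :> M -> R;
  Cinf_valP : Cinf_val \in smooth_pred }.

HB.instance Definition _ := [isSub for Cinf_val].
HB.instance Definition _ := [Choice of Cinf by <:].
HB.instance Definition _ := GRing.SubChoice_isSubComPzRing.Build _ _ Cinf (@smooth_subring).
HB.instance Definition _ := [SubZmodule_isSubLmodule of Cinf by <:].

End SmoothFunctions.

Section TangentSpaces.
Context (R : realType) (n : nat) (M : manifold R n).

(* Tangent vectors at p are the derivations at p of C^oo(M). *)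
Definition derivation_at (p : M) (v : Cinf M -> R) :=
  (forall (a : R) (f g : Cinf M), v (a *: f + g) = a * v f + v g) /\
  (forall f g : Cinf M, v (f * g) = v f * g p + f p * v g).

Definition tangent_pred (p : M) : {pred Cinf M -> R} :=
  fun v => `[< derivation_at p v >].

Lemma tangent_submod (p : M) : submod_closed (tangent_pred p).
Proof.
split.
  apply/asboolP; split=> [a f g|f g]; rewrite -![(0 : _ -> _) _]/(0 : R).
    by rewrite mulr0 addr0.
  by rewrite mul0r mulr0 addr0.
move=> a u v /asboolP[lu Lu] /asboolP[lv Lv]; apply/asboolP.
have E f : (a *: u + v) f = a * u f + v f by [].
split=> [b f g|f g]; rewrite !E.
  by rewrite lu lv !mulrDr !mulrA (mulrC a b) addrACA.
rewrite Lu Lv mulrDr !mulrDl mulrDr addrACA !mulrA.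
by rewrite (mulrC (f p) a).
Qed.

HB.instance Definition _ (p : M) :=
  GRing.isSubmodClosed.Build R (Cinf M -> R) (tangent_pred p)
    (tangent_submod p).

Record tangent (p : M) := Tangent {
  tangent_val :> Cinf M -> R;
  tangent_valP : tangent_val \in tangent_pred p }.

HB.instance Definition _ (p : M) := [isSub for @tangent_val p].
HB.instance Definition _ (p : M) := [Choice of tangent p by <:].
HB.instance Definition _ (p : M) := [SubChoice_isSubLmodule of tangent p by <:].

Lemma tangent_linear p (v : tangent p) (a : R) (f g : Cinf M) :
  v (a *: f + g) = a * v f + v g.
Proof. by have /asboolP[+ _] := tangent_valP v; apply. Qed.

Lemma tangentM p (v : tangent p) (f g : Cinf M) :
  v (f * g) = v f * g p + f p * v g.
Proof. by have /asboolP[_] := tangent_valP v; apply. Qed.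

Lemma tangentD p (v : tangent p) (f g : Cinf M) : v (f + g) = v f + v g.
Proof. by rewrite -[f]scale1r tangent_linear mul1r scale1r. Qed.

Lemma tangentP p (u v : tangent p) : (forall f, u f = v f) -> u = v.
Proof. by move=> uv; apply/val_inj/funext. Qed.

(* Smooth sections of the tangent bundle. *)
Record vfield := VField {
  vf_val :> forall p : M, tangent p;
  vf_smooth : forall f : Cinf M, smooth_fun (fun p => vf_val p f) }.

Lemma vfieldP (X Y : vfield) : (forall p, X p = Y p) -> X = Y.
Proof.
case: X Y => [X sX] [Y sY] /= XY.
have {XY}E : X = Y by apply: functional_extensionality_dep.
by subst Y; congr VField; exact: Prop_irrelevance.
Qed.

Definition mkCinf (f : M -> R) (sf : smooth_fun f) : Cinf M :=
  MkCinf (asboolT sf).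

Lemma Cinf_smooth (f : Cinf M) : smooth_fun f.
Proof. exact/asboolP/(Cinf_valP f). Qed.

Lemma CinfP (f g : Cinf M) : (forall p, f p = g p) -> f = g.
Proof. by move=> fg; apply/val_inj/funext. Qed.

Definition vf_app (X : vfield) (f : Cinf M) : Cinf M :=
  mkCinf (vf_smooth X f).

Let zero_smooth (f : Cinf M) : smooth_fun (fun p => (0 : tangent p) f).
Proof. exact: (smooth_cst 0). Qed.
Let add_smooth (X Y : vfield) (f : Cinf M) : smooth_fun (fun p => (X p + Y p) f).
Proof. by apply: (smoothD (vf_smooth X f) (vf_smooth Y f)). Qed.
Let opp_smooth (X : vfield) (f : Cinf M) : smooth_fun (fun p => (- X p) f).
Proof. by have := smoothZ (-1) (vf_smooth X f); rewrite scaleN1r. Qed.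
Let scale_smooth (h : Cinf M) (X : vfield) (f : Cinf M) :
  smooth_fun (fun p => (h p *: X p) f).
Proof. exact: (smoothM (Cinf_smooth h) (vf_smooth X f)). Qed.

Definition vf_zero := VField zero_smooth.
Definition vf_add X Y := VField (add_smooth X Y).
Definition vf_opp X := VField (opp_smooth X).
Definition vf_scale h X := VField (scale_smooth h X).

HB.instance Definition _ := gen_eqMixin vfield.
HB.instance Definition _ := gen_choiceMixin vfield.

Let vf_addA : associative vf_add.
Proof. by move=> X Y Z; apply: vfieldP => p /=; exact: addrA. Qed.
Let vf_addC : commutative vf_add.
Proof. by move=> X Y; apply: vfieldP => p /=; exact: addrC. Qed.
Let vf_add0 : left_id vf_zero vf_add.
Proof. by move=> X; apply: vfieldP => p /=; exact: add0r. Qed.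
Let vf_addN : left_inverse vf_zero vf_opp vf_add.
Proof. by move=> X; apply: vfieldP => p /=; exact: addNr. Qed.

HB.instance Definition _ :=
  GRing.isZmodule.Build vfield vf_addA vf_addC vf_add0 vf_addN.

Let vf_scaleA f g X : vf_scale f (vf_scale g X) = vf_scale (f * g) X.
Proof. by apply: vfieldP => p /=; exact: scalerA. Qed.
Let vf_scale1 : left_id 1 vf_scale.
Proof. by move=> X; apply: vfieldP => p /=; exact: scale1r. Qed.
Let vf_scaleDr : right_distributive vf_scale +%R.
Proof. by move=> f X Y; apply: vfieldP => p /=; exact: scalerDr. Qed.
Let vf_scaleDl X : {morph vf_scale^~ X : f g / f + g}.
Proof. by move=> f g; apply: vfieldP => p /=; exact: scalerDl. Qed.

HB.instance Definition _ := GRing.Zmodule_isLmodule.Build (Cinf M) vfield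
  vf_scaleA vf_scale1 vf_scaleDr vf_scaleDl.

Let bracket_val (X Y : vfield) (p : M) (f : Cinf M) : R :=
  X p (vf_app Y f) - Y p (vf_app X f).

Let bracket_tangent X Y p : bracket_val X Y p \in tangent_pred p.
Proof.
apply/asboolP; rewrite /bracket_val.
have EL (Z : vfield) a f g : vf_app Z (a *: f + g) = a *: vf_app Z f + vf_app Z g.
  by apply: CinfP => q; exact: tangent_linear.
have EM (Z : vfield) f g : vf_app Z (f * g) = vf_app Z f * g + f * vf_app Z g.
  by apply: CinfP => q; exact: tangentM.
split=> [a f g|f g].
  by rewrite !EL !tangent_linear; ring.
rewrite !EM !tangentD !tangentM /=; ring.
Qed.

Let bracket_smooth X Y (f : Cinf M) :
  smooth_fun (fun p => Tangent (bracket_tangent X Y p) f).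
Proof. exact: (smoothB (vf_smooth X (vf_app Y f)) (vf_smooth Y (vf_app X f))). Qed.

(* [X, Y] f = X (Y f) - Y (X f) *)
Definition lie_bracket (X Y : vfield) : vfield := VField (bracket_smooth X Y).

End TangentSpaces.

Section Tensors.
Context (R : realType) (n : nat) (M : manifold R n).

(* Smooth (0,2)-tensor fields. *)
Record tensor02 := Tensor02 {
  t02_val :> forall p : M, tangent p -> tangent p -> R;
  t02_linl : forall p (a : R) (u v w : tangent p),
    t02_val (a *: u + v) w = a * t02_val u w + t02_val v w;
  t02_linr : forall p (a : R) (u v w : tangent p),
    t02_val w (a *: u + v) = a * t02_val w u + t02_val w v;
  t02_smooth : forall X Y : vfield M,
    smooth_fun (fun p => t02_val (X p) (Y p)) }.

Definition t02_app (B : tensor02) (X Y : vfield M) : Cinf M :=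
  mkCinf (t02_smooth B X Y).

(* Smooth (1,1)-tensor fields, as endomorphisms of the tangent bundle. *)
Record endo_field := EndoField {
  endo_val :> forall p : M, {linear tangent p -> tangent p};
  endo_smooth : forall (X : vfield M) (f : Cinf M),
    smooth_fun (fun p => endo_val p (X p) f) }.

Definition endo_app (E : endo_field) (X : vfield M) : vfield M :=
  VField (endo_smooth E X).

Definition riemannian_metric (g : tensor02) :=
  (forall p (u v : tangent p), g p u v = g p v u) /\
  (forall p (v : tangent p), v != 0 -> 0 < g p v v).

Definition alternating (omega : tensor02) :=
  forall p (v : tangent p), omega p v v = 0.

Definition nondegenerate (omega : tensor02) :=
  forall p (u : tangent p), (forall v, omega p u v = 0) -> u = 0.

(* Exterior derivative of a 2-form evaluated on three vector fields. *)
Definition ext_deriv (omega : tensor02) (X Y Z : vfield M) : Cinf M :=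
  vf_app X (t02_app omega Y Z) - vf_app Y (t02_app omega X Z)
  + vf_app Z (t02_app omega X Y)
  - t02_app omega (lie_bracket X Y) Z + t02_app omega (lie_bracket X Z) Y
  - t02_app omega (lie_bracket Y Z) X.

Definition symplectic (omega : tensor02) :=
  [/\ alternating omega, nondegenerate omega &
      forall X Y Z, ext_deriv omega X Y Z = 0].

Definition almost_complex (Theta : endo_field) :=
  forall p (v : tangent p), Theta p (Theta p v) = - v.

Definition almost_hermitian (g : tensor02) (Theta : endo_field) :=
  [/\ almost_complex Theta, riemannian_metric g &
      forall p (u v : tangent p), g p (Theta p u) (Theta p v) = g p u v].

Definition almost_kahler (omega : tensor02) (Theta : endo_field)
    (g : tensor02) :=
  [/\ symplectic omega, almost_hermitian g Theta &
      forall p (u v : tangent p), omega p u v = g p (Theta p u) v].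

End Tensors.

Section Connections.
Context (R : realType) (n : nat) (M : manifold R n).

(* Linear connections on the tangent bundle (Koszul). *)
Record connection := Connection {
  conn :> vfield M -> vfield M -> vfield M;
  conn_linl : forall (f : Cinf M) (X Y Z : vfield M),
    conn (f *: X + Y) Z = f *: conn X Z + conn Y Z;
  connD : forall X Y Z : vfield M, conn X (Y + Z) = conn X Y + conn X Z;
  conn_leibniz : forall (f : Cinf M) (X Y : vfield M),
    conn X (f *: Y) = vf_app X f *: Y + f *: conn X Y }.

Definition torsion (D : connection) (X Y : vfield M) : vfield M :=
  D X Y - D Y X - lie_bracket X Y.

Definition torsion_free (D : connection) := forall X Y, torsion D X Y = 0.

(* (D_X B)(Y, Z) *)
Definition cov_deriv (D : connection) (B : tensor02 M) (X Y Z : vfield M)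
    : Cinf M :=
  vf_app X (t02_app B Y Z) - t02_app B (D X Y) Z - t02_app B Y (D X Z).

Definition parallel (D : connection) (B : tensor02 M) :=
  forall X Y Z, cov_deriv D B X Y Z = 0.

Definition levi_civita (g : tensor02 M) (D : connection) :=
  torsion_free D /\ parallel D g.

Definition dual_connections (g : tensor02 M) (D D' : connection) :=
  forall X Y Z : vfield M,
    vf_app X (t02_app g Y Z) = t02_app g (D X Y) Z + t02_app g Y (D' X Z).

Definition smat_connections (omega g : tensor02 M) (D D' : connection) :=
  [/\ dual_connections g D D', parallel D omega & torsion_free D].

Lemma t02_app_eq0 (g : tensor02 M) (X : vfield M) : riemannian_metric g ->
  t02_app g X X = 0 -> X = 0.
Proof.
move=> [_ pos] E; apply: vfieldP => p; apply/eqP/contraT => /pos.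
have -> : g p (X p) (X p) = t02_app g X X p by [].
by rewrite E -[(0 : Cinf M) p]/(0 : R) ltxx.
Qed.

Lemma t02_appBl (B : tensor02 M) (X Y Z : vfield M) p :
  t02_app B (X - Y) Z p = t02_app B X Z p - t02_app B Y Z p.
Proof. by rewrite /= addrC -scaleN1r t02_linl mulN1r addrC. Qed.

Lemma levi_civita_unique (g : tensor02 M) (D D' : connection) :
  riemannian_metric g -> levi_civita g D -> levi_civita g D' ->
  forall X Y, D X Y = D' X Y.
Proof.
move=> rg [tD mD] [tD' mD'] X Y; have [gC _] := rg.
pose b U V W p := t02_app g (D U V - D' U V) W p.
have b12 U V W p : b U V W p = b V U W p.
  congr (t02_app g _ W p).
  have /eqP := etrans (subr0_eq (tD U V)) (esym (subr0_eq (tD' U V))).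
  rewrite subr_eq => /eqP ->.
  by rewrite -[X in X - _]addrA [X in X - _]addrC addrK addrC.
have b23 U V W p : b U V W p = - b U W V p.
  have E f1 f2 f3 : (f1 - f2 - f3 : Cinf M) p = f1 p - f2 p - f3 p by [].
  have /(congr1 (fun f : Cinf M => f p)) := mD U V W.
  have /(congr1 (fun f : Cinf M => f p)) := mD' U V W.
  rewrite /b !t02_appBl /cov_deriv !E -[(0 : Cinf M) p]/(0 : R).
  rewrite [t02_app g V (D U W) p]gC [t02_app g V (D' U W) p]gC /=; lra.
have b0 U V W p : b U V W p = 0.
  have := b23 U V W p; have := b12 U W V p; have := b23 W U V p.
  have := b12 W V U p; have := b23 V W U p; have := b12 V U W p; lra.
apply/subr0_eq/(t02_app_eq0 rg)/CinfP => p; exact: b0.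
Qed.

(* The Levi-Civita connection of g exists and is unique (uniqueness is
   [levi_civita_unique]), so "it satisfies P" is "some Levi-Civita connection
   satisfies P". *)
Definition kahler (omega : tensor02 M) (Theta : endo_field M)
    (g : tensor02 M) :=
  almost_kahler omega Theta g /\
  exists2 D, levi_civita g D & parallel D omega.

Definition statistical_almost_kahler (omega : tensor02 M)
    (Theta : endo_field M) (g : tensor02 M) :=
  almost_kahler omega Theta g /\
  exists D D', smat_connections omega g D D' /\ torsion_free D'.

End Connections.

(* Main.v *)
Require Import Defs.
From mathcomp Require Import all_boot all_order all_algebra.
From mathcomp Require Import all_classical all_reals all_analysis.
From mathcomp Require Import lra.

(** Why the theorem holds.  If [(g, omega)] is Kähler, its Levi-Civita
    connection is its own dual, so the pair it forms with itself is the
    required one.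

    Conversely let [D], [D'] be dual torsion-free connections with
    [D omega = 0].  As [omega(Y, Z) = g(Theta Y, Z)], differentiating this
    function along [X] once with [D omega = 0] and once with duality gives
    [D'_X (Theta Y) = Theta (D_X Y)] ([dual_Theta]).  Because
    [Theta^2 = -1], applying this to [Theta Y] also gives
    [D_X (Theta Y) = Theta (D'_X Y)] ([dual_Theta_sym]): conjugation by
    [Theta] exchanges the two connections.  Hence [D' omega = 0] as well
    ([dual_parallel]), and [omega] is parallel for the mean of [D] and [D'].
    The mean of a dual pair is metric ([mean_metric]), and torsion-freeness
    passes to it, so it is the Levi-Civita connection of [g]. *)

Set Implicit Arguments.
Unset Strict Implicit.
Unset Printing Implicit Defensive.

Import Order.TTheory GRing.Theory Num.Theory.
Local Open Scope ring_scope.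

Section Linearity.
Context (R : realType) (n : nat) (M : manifold R n).
Implicit Types (B g : tensor02 M) (D : connection M) (X Y Z : vfield M).

Lemma t02_app_linl B (f : Cinf M) X Y Z :
  t02_app B (f *: X + Y) Z = f * t02_app B X Z + t02_app B Y Z.
Proof. by apply: CinfP => p; exact: t02_linl. Qed.

Lemma t02_app_linr B (f : Cinf M) X Y Z :
  t02_app B Z (f *: X + Y) = f * t02_app B Z X + t02_app B Z Y.
Proof. by apply: CinfP => p; exact: t02_linr. Qed.

Lemma t02_appDl B X Y Z : t02_app B (X + Y) Z = t02_app B X Z + t02_app B Y Z.
Proof. by rewrite -{1}(scale1r X) t02_app_linl mul1r. Qed.

Lemma t02_appDr B X Y Z : t02_app B Z (X + Y) = t02_app B Z X + t02_app B Z Y.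
Proof. by rewrite -{1}(scale1r X) t02_app_linr mul1r. Qed.

Lemma t02_app0l B Z : t02_app B 0 Z = 0.
Proof. by apply: (addIr (t02_app B 0 Z)); rewrite -t02_appDl !add0r. Qed.

Lemma t02_app0r B Z : t02_app B Z 0 = 0.
Proof. by apply: (addIr (t02_app B Z 0)); rewrite -t02_appDr !add0r. Qed.

Lemma t02_appZl B (f : Cinf M) X Z : t02_app B (f *: X) Z = f * t02_app B X Z.
Proof. by rewrite -[f *: X]addr0 t02_app_linl t02_app0l addr0. Qed.

Lemma t02_appZr B (f : Cinf M) X Z : t02_app B Z (f *: X) = f * t02_app B Z X.
Proof. by rewrite -[f *: X]addr0 t02_app_linr t02_app0r addr0. Qed.

Lemma metric_appC g X Y : riemannian_metric g -> t02_app g X Y = t02_app g Y X.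
Proof. by case=> gC _; apply: CinfP => p; exact: gC. Qed.

Lemma metric_inj g X Y : riemannian_metric g ->
  (forall Z, t02_app g X Z = t02_app g Y Z) -> X = Y.
Proof.
move=> rg XY; apply/subr0_eq/(t02_app_eq0 rg)/CinfP => p.
by rewrite t02_appBl XY subrr.
Qed.

Lemma connN D X Y : D X (- Y) = - D X Y.
Proof.
have D0 : D X 0 = 0 by apply: (addIr (D X 0)); rewrite -connD !add0r.
by apply: (addIr (D X Y)); rewrite -connD !addNr.
Qed.

Lemma endo_appN (E : endo_field M) X : endo_app E (- X) = - endo_app E X.
Proof. by apply: vfieldP => p; exact: raddfN. Qed.

End Linearity.

Section AffineCombination.
Context (R : realType) (n : nat) (M : manifold R n).
Variables (a b : Cinf M) (ab1 : a + b = 1) (D D' : connection M).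

Let aff (X Y : vfield M) := a *: D X Y + b *: D' X Y.

Let aff_linl (f : Cinf M) (X Y Z : vfield M) :
  aff (f *: X + Y) Z = f *: aff X Z + aff Y Z.
Proof.
by rewrite /aff !conn_linl !scalerDr !scalerA (mulrC a) (mulrC b) addrACA.
Qed.

Let affD (X Y Z : vfield M) : aff X (Y + Z) = aff X Y + aff X Z.
Proof. by rewrite /aff !connD !scalerDr addrACA. Qed.

Let aff_leibniz (f : Cinf M) (X Y : vfield M) :
  aff X (f *: Y) = vf_app X f *: Y + f *: aff X Y.
Proof.
rewrite /aff !conn_leibniz !scalerDr addrACA !scalerA (mulrC a f) (mulrC b f).
by rewrite -scalerDl -mulrDl ab1 mul1r.
Qed.

(** The coefficients must sum to [1] because each connection contributes
    its own copy of the term [(X f) *: Y] to the Leibniz rule. *)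
Definition conn_affine : connection M := Connection aff_linl affD aff_leibniz.

Lemma torsion_affine (X Y : vfield M) :
  torsion conn_affine X Y = a *: torsion D X Y + b *: torsion D' X Y.
Proof.
rewrite /torsion -{1}[lie_bracket X Y]scale1r -ab1 scalerDl /= /aff !scalerBr.
by rewrite !opprD [a *: D X Y + _ + _]addrACA [LHS]addrACA.
Qed.

Lemma cov_deriv_affine (B : tensor02 M) (X Y Z : vfield M) :
  cov_deriv conn_affine B X Y Z =
  a * cov_deriv D B X Y Z + b * cov_deriv D' B X Y Z.
Proof.
rewrite /cov_deriv -{1}[vf_app X _]mul1r -ab1 mulrDl /= /aff.
rewrite !t02_appDl !t02_appDr !t02_appZl !t02_appZr !mulrBr.
by rewrite !opprD [a * vf_app _ _ + _ + _]addrACA [LHS]addrACA.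
Qed.

Lemma torsion_free_affine :
  torsion_free D -> torsion_free D' -> torsion_free conn_affine.
Proof. by move=> tD tD' X Y; rewrite torsion_affine tD tD' !scaler0 addr0. Qed.

Lemma parallel_affine (B : tensor02 M) :
  parallel D B -> parallel D' B -> parallel conn_affine B.
Proof.
by move=> pD pD' X Y Z; rewrite cov_deriv_affine pD pD' !mulr0 addr0.
Qed.

End AffineCombination.

Section DualConnections.
Context (R : realType) (n : nat) (M : manifold R n).
Variables (g : tensor02 M) (rg : riemannian_metric g).
Implicit Types (D : connection M) (X Y Z : vfield M).

Lemma dual_self D : parallel D g -> dual_connections g D D.
Proof.
by move=> pD X Y Z; apply/subr0_eq; rewrite opprD addrA; exact: pD.
Qed.

Lemma dual_sym D D' : dual_connections g D D' -> dual_connections g D' D.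
Proof.
move=> dDD' X Y Z; rewrite (metric_appC Y Z rg) dDD' addrC.
by rewrite (metric_appC Z _ rg) (metric_appC _ Y rg).
Qed.

(** With [K = D' - D], the two terms are [g(Y, K_X Z)] and [- g(Y, K_X Z)]
    by duality read in both directions. *)
Lemma cov_deriv_dual D D' : dual_connections g D D' -> forall X Y Z,
  cov_deriv D g X Y Z + cov_deriv D' g X Y Z = 0.
Proof.
move=> dDD' X Y Z; rewrite /cov_deriv {1}dDD' (dual_sym dDD').
rewrite [_ + t02_app g Y (D' X Z)]addrC addrK.
by rewrite [_ + t02_app g Y (D X Z)]addrC addrK addrC subrKA subrr.
Qed.

Let half : Cinf M := mkCinf (smooth_cst (M := M) 2^-1).

Let half_half : half + half = 1.
Proof.
by apply: CinfP => p; rewrite -[LHS]/(2^-1 + 2^-1 : R) -[RHS]/(1 : R); lra.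
Qed.

Definition mean_conn D D' := conn_affine half_half D D'.

Lemma mean_metric D D' : dual_connections g D D' -> parallel (mean_conn D D') g.
Proof.
by move=> dDD' X Y Z; rewrite cov_deriv_affine -mulrDr cov_deriv_dual// mulr0.
Qed.

End DualConnections.

Section AlmostHermitian.
Context (R : realType) (n : nat) (M : manifold R n).
Variables (omega : tensor02 M) (Theta : endo_field M) (g : tensor02 M).
Hypotheses (hg : almost_hermitian g Theta)
  (omegaE : forall p (u v : tangent p), omega p u v = g p (Theta p u) v).
Variables (D D' : connection M).
Hypotheses (dDD' : dual_connections g D D') (pD : parallel D omega).
Implicit Types X Y Z : vfield M.

Let rg : riemannian_metric g. Proof. by case: hg. Qed.

Let omega_app X Y : t02_app omega X Y = t02_app g (endo_app Theta X) Y.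
Proof. by apply: CinfP => p; exact: omegaE. Qed.

Let ThetaK X : endo_app Theta (endo_app Theta X) = - X.
Proof. by case: hg => JJ _ _; apply: vfieldP => p; exact: JJ. Qed.

(** Both sides represent, through [g], the 1-form
    [Z |-> X (omega(Y, Z)) - omega(Y, D_X Z)]. *)
Lemma dual_Theta X Y : D' X (endo_app Theta Y) = endo_app Theta (D X Y).
Proof.
apply: (metric_inj rg) => Z; have := dual_sym rg dDD' X (endo_app Theta Y) Z.
have /subr0_eq/eqP := pD X Y Z.
by rewrite !omega_app subr_eq => /eqP -> /esym; rewrite addrC => /addrI.
Qed.

Lemma dual_Theta_sym X Y : D X (endo_app Theta Y) = endo_app Theta (D' X Y).
Proof.
apply: oppr_inj; rewrite -ThetaK -dual_Theta ThetaK connN.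
by rewrite endo_appN.
Qed.

(** Since [Theta (D'_X Y) = D_X (Theta Y)], the vanishing of
    [(D'_X omega)(Y, Z)] is the duality identity for [Theta Y] and [Z]. *)
Lemma dual_parallel : parallel D' omega.
Proof.
move=> X Y Z; rewrite /cov_deriv !omega_app -dual_Theta_sym dDD'.
by rewrite [X in X - _]addrC addKr subrr.
Qed.

End AlmostHermitian.

Theorem proposition6p7 (R : realType) (d : nat) (M : manifold R (2 * d)%N)
    (omega : tensor02 M) (Theta : endo_field M) (g : tensor02 M)
    (hAK : almost_kahler omega Theta g) :
  (kahler omega Theta g <-> statistical_almost_kahler omega Theta g) /\
  (kahler omega Theta g <->
   exists D Dstar : connection M,
     [/\ torsion_free D, torsion_free Dstar, dual_connections g D Dstar &
         parallel D omega]).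
Proof.
have [_ hg omegaE] := hAK; have [_ rg _] := hg.
pose pair (D D' : connection M) := [/\ torsion_free D, torsion_free D',
  dual_connections g D D' & parallel D omega].
have to_pair : kahler omega Theta g -> exists D D', pair D D'.
  by move=> [_ [D [tD gD] oD]]; exists D, D; split=> //; exact: dual_self.
have of_pair D D' : pair D D' -> kahler omega Theta g.
  move=> [tD tD' dDD' oD]; split=> //; exists (mean_conn D D').
    by split; [exact: torsion_free_affine|exact: mean_metric].
  exact: parallel_affine oD (dual_parallel hg omegaE dDD' oD).
split; split.
- move=> /to_pair[D [D' [tD tD' dDD' oD]]]; split=> //.
  by exists D, D'; split.
- by move=> [_ [D [D' [[dDD' oD tD] tD']]]]; exact: (of_pair D D').
- exact: to_pair.
- by move=> [D [D' /of_pair]].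
Qed.
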